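(* For every integer $n\ge1$ and every $f\in\mathcal{T}_n$, $$\|f\|_{[0,1]} \le \frac{\pi n}{2}\, \|f\|_{L_2[0,1]}.$$
   Context: For an integer $n\ge1$, $\mathcal{T}_n$ denotes the set of all functions $f:\mathbb{R}\to\mathbb{C}$ of the form $f(t)=\sum_{j=1}^n a_j e^{i\lambda_j t}$ with $a_j\in\mathbb{C}$ (possibly zero) and real exponents $\lambda_1<\lambda_2<\cdots<\lambda_n$. For $A\subset\mathbb{R}$, $\|f\|_A:=\sup_{t\in A}|f(t)|$; $\|f\|_{L_2[0,1]}=(\int_0^1|f|^2)^{1/2}$. *)

(* Defs.v *)
From Stdlib Require Import Reals.
Open Scope R_scope.

Fixpoint sumR (n : nat) (g : nat -> R) : R :=
  match n with
  | O => 0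
  | S k => sumR k g + g k
  end.

(* f(t) = sum_{j<n} (a j + i b j) e^{i lam_j t};  real and imaginary parts *)
Definition expsum_re (n : nat) (a b lam : nat -> R) (t : R) : R :=
  sumR n (fun j => a j * cos (lam j * t) - b j * sin (lam j * t)).

Definition expsum_im (n : nat) (a b lam : nat -> R) (t : R) : R :=
  sumR n (fun j => a j * sin (lam j * t) + b j * cos (lam j * t)).

Definition expsum_abs2 (n : nat) (a b lam : nat -> R) (t : R) : R :=
  (expsum_re n a b lam t)^2 + (expsum_im n a b lam t)^2.

Definition expsum_abs (n : nat) (a b lam : nat -> R) (t : R) : R :=
  sqrt (expsum_abs2 n a b lam t).

(* Main.v *)
(** Restricting to the segments [[t,1]] and [[0,t]] and adding up, it suffices to bound
    [|f(t)|] when [t] is an endpoint.  Sample [f] at [t + k s] for [k <= n (m-1)].  Suppose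
    a polynomial [P = sum_k p_k z^k] of degree [n (m-1)] vanishes at every
    [e^(i lam_j s)], with [p_0 = c] and [sum_k |p_k|^2 <= 1].  Then
    [c f(t) = - sum_(k>=1) p_k f(t + k s)], so by Cauchy-Schwarz
    [c^2 |f(t)|^2 <= (1 - c^2) sum_(k>=1) |f(t + k s)|^2].

    Such a [P], with [c = cos(pi/2m)^(nm)], is a product of [n] factors of degree [m-1]:
    the lower right entry of [(R diag(w z, 1))^m], where [R] is the plane rotation by
    [pi/2m] and [w = e^(-i lam_j s)].  On the unit circle this matrix is unitary, so the
    coefficients do not gain energy; at [w z = 1] it is the rotation by [pi/2], whose
    diagonal is zero; at [z = 0] its entry is [cos(pi/2m)^m].  Since
    [c^2 >= 1 - n pi^2/4m], the limit [m -> oo] turns the samples into a Riemann sum and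
    gives the constant [(pi n/2)^2]. *)
Require Import Defs.
From Stdlib Require Import Reals Lra Lia.
From Coquelicot Require Import Coquelicot.
Open Scope R_scope.

(** * Finite sums over the reals and the complex numbers *)

Lemma sumR_ext (n : nat) (g h : nat -> R) :
  (forall k, (k < n)%nat -> g k = h k) -> sumR n g = sumR n h.
Proof.
  induction n as [|n IH]; intros H; simpl; [reflexivity|].
  rewrite IH by (intros; apply H; lia). now rewrite H by lia.
Qed.

Lemma sumR_plus (n : nat) (g h : nat -> R) :
  sumR n (fun k => g k + h k) = sumR n g + sumR n h.
Proof. induction n as [|n IH]; simpl; [ring|rewrite IH; ring]. Qed.

Lemma sumR_pos (n : nat) (g : nat -> R) :
  (forall k, 0 <= g k) -> 0 <= sumR n g.
Proof.
  intros H; induction n as [|n IH]; simpl; [lra|].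
  specialize (H n); lra.
Qed.

Lemma sumR_first (n : nat) (g : nat -> R) :
  sumR (S n) g = g O + sumR n (fun k => g (S k)).
Proof.
  induction n as [|n IH]; [simpl; ring|].
  change (sumR (S n) g + g (S n) = g O + (sumR n (fun k => g (S k)) + g (S n))).
  rewrite IH; ring.
Qed.

Fixpoint sumC (n : nat) (g : nat -> C) : C :=
  match n with
  | O => 0%C
  | S k => (sumC k g + g k)%C
  end.

Lemma sumC_ext (n : nat) (g h : nat -> C) :
  (forall k, (k < n)%nat -> g k = h k) -> sumC n g = sumC n h.
Proof.
  induction n as [|n IH]; intros H; simpl; [reflexivity|].
  rewrite IH by (intros; apply H; lia). now rewrite H by lia.
Qed.

Lemma sumC_lin (n : nat) (x y : C) (g h : nat -> C) :
  sumC n (fun k => x * g k + y * h k)%C = (x * sumC n g + y * sumC n h)%C.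
Proof. induction n as [|n IH]; simpl; [ring|rewrite IH; ring]. Qed.

Lemma sumC_first (n : nat) (g : nat -> C) :
  sumC (S n) g = (g O + sumC n (fun k => g (S k)))%C.
Proof.
  induction n as [|n IH]; [simpl; ring|].
  change (sumC (S n) g + g (S n) = g O + (sumC n (fun k => g (S k)) + g (S n)))%C.
  rewrite IH; ring.
Qed.

(** * Squared modulus and the Cauchy-Schwarz inequality *)

Definition abs2 (z : C) : R := fst z ^ 2 + snd z ^ 2.

Lemma abs2_pos (z : C) : 0 <= abs2 z.
Proof. unfold abs2; nra. Qed.

Lemma abs2_mult (z w : C) : abs2 (z * w)%C = abs2 z * abs2 w.
Proof. unfold abs2; simpl; ring. Qed.

Lemma abs2_rotate (c s : R) (z w : C) :
  c ^ 2 + s ^ 2 = 1 ->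
  abs2 (c * z + (- s) * w)%C + abs2 (s * z + c * w)%C = abs2 z + abs2 w.
Proof.
  intros H; unfold abs2; simpl.
  transitivity ((c ^ 2 + s ^ 2) * (fst z ^ 2 + snd z ^ 2 + fst w ^ 2 + snd w ^ 2));
    [ring | rewrite H; ring].
Qed.

(** Induction step for Cauchy-Schwarz: [x] and [y] stand for the two partial sums of squares, and
    [u * v] is the next term. *)
Lemma abs2_plus_le (z w : C) (x y : R) :
  0 <= x -> 0 <= y -> abs2 z <= x * y ->
  forall u v, w = (u * v)%C -> abs2 (z + w)%C <= (x + abs2 u) * (y + abs2 v).
Proof.
  intros Hx Hy Hz u v ->.
  pose proof (abs2_pos u) as Hu; pose proof (abs2_pos v) as Hv.
  set (a := abs2 u) in *; set (b := abs2 v) in *.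
  set (d := fst z * fst (u * v)%C + snd z * snd (u * v)%C).
  assert (Hd : d ^ 2 <= abs2 z * abs2 (u * v)%C).
  { unfold d, abs2.
    pose proof (pow2_ge_0 (fst z * snd (u * v)%C - snd z * fst (u * v)%C)). nra. }
  assert (E : abs2 (z + u * v)%C = abs2 z + 2 * d + a * b).
  { unfold d, a, b; rewrite <- abs2_mult; unfold abs2; simpl; ring. }
  rewrite abs2_mult in Hd; fold a b in Hd.
  (* By AM-GM, [4 d^2 <= 4 (x b) (a y) <= (x b + a y)^2]. *)
  assert (H : 2 * d <= x * b + a * y).
  { apply Rsqr_incr_0_var; [|nra]. unfold Rsqr.
    assert (abs2 z * (a * b) <= x * y * (a * b)) by (apply Rmult_le_compat_r; nra).
    pose proof (pow2_ge_0 (x * b - a * y)). nra. }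
  rewrite E. nra.
Qed.

Lemma cauchy_schwarz (n : nat) (g h : nat -> C) :
  abs2 (sumC n (fun k => g k * h k)%C)
  <= sumR n (fun k => abs2 (g k)) * sumR n (fun k => abs2 (h k)).
Proof.
  induction n as [|n IH]; simpl.
  - unfold abs2; simpl; lra.
  - eapply abs2_plus_le; [| |exact IH|reflexivity];
      apply sumR_pos; intros; apply abs2_pos.
Qed.

(** * The unit circle, and polynomials given by coefficient sequences *)

Definition cis (x : R) : C := (cos x, sin x).

Lemma cis_plus (x y : R) : cis (x + y) = (cis x * cis y)%C.
Proof.
  unfold cis, Cmult; simpl. rewrite cos_plus, sin_plus; f_equal; ring.
Qed.

Lemma abs2_cis (x : R) : abs2 (cis x) = 1.
Proof. unfold abs2, cis; simpl. pose proof (sin2_cos2 x). unfold Rsqr in *; lra. Qed.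

Lemma cis_0 : cis 0 = 1%C.
Proof. unfold cis; now rewrite cos_0, sin_0. Qed.

Lemma cis_mult_nat (x : R) (k : nat) : cis (INR k * x) = (cis x ^ k)%C.
Proof.
  induction k as [|k IH].
  - simpl. now rewrite Rmult_0_l, cis_0.
  - rewrite S_INR. replace ((INR k + 1) * x) with (x + INR k * x) by ring.
    now rewrite cis_plus, IH.
Qed.

Definition eval (n : nat) (p : nat -> C) (z : C) : C :=
  sumC n (fun k => p k * z ^ k)%C.

Lemma eval_lin (n : nat) (x y : C) (p q : nat -> C) (z : C) :
  eval n (fun k => x * p k + y * q k)%C z = (x * eval n p z + y * eval n q z)%C.
Proof.
  unfold eval; rewrite <- sumC_lin. apply sumC_ext; intros; ring.
Qed.

Lemma eval_zero (n : nat) (z : C) : eval n (fun _ => 0%C) z = 0%C.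
Proof.
  unfold eval; induction n as [|n IH]; simpl; [reflexivity|rewrite IH; ring].
Qed.

(** The coefficients of [w z p(z)], that is, the action of the entry [w z] of [diag(w z, 1)]. *)
Definition shift (w : C) (p : nat -> C) (k : nat) : C :=
  match k with
  | O => 0%C
  | S k' => (w * p k')%C
  end.

Lemma eval_shift (n : nat) (w : C) (p : nat -> C) (z : C) :
  eval (S n) (shift w p) z = (w * z * eval n p z)%C.
Proof.
  unfold eval; rewrite sumC_first; simpl.
  (* The zero multiple is a dummy second term that gives the sum the shape of [sumC_lin]. *)
  transitivity (sumC n (fun k => (w * z) * (p k * z ^ k) + 0 * (p k * z ^ k))%C).
  - rewrite Cmult_0_l, Cplus_0_l. apply sumC_ext; intros; ring.
  - rewrite sumC_lin; ring.
Qed.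

Lemma sum_abs2_shift (n : nat) (w : C) (p : nat -> C) :
  abs2 w = 1 ->
  sumR (S n) (fun k => abs2 (shift w p k)) = sumR n (fun k => abs2 (p k)).
Proof.
  intros Hw; rewrite sumR_first; simpl.
  replace (abs2 0) with 0 by (unfold abs2; simpl; ring).
  rewrite Rplus_0_l. apply sumR_ext; intros. rewrite abs2_mult, Hw; ring.
Qed.

(* [u, v] are the entries of [(R diag(w z, 1))^(i+1) (0, p)], with [R] the rotation by [x]. *)
Lemma rotation_block (d : nat) (p : nat -> C) (w : C) (x : R) (i : nat) :
  abs2 w = 1 ->
  (forall k, (d <= k)%nat -> p k = 0%C) ->
  exists u v : nat -> C,
    (forall k, (d + i <= k)%nat -> u k = 0%C /\ v k = 0%C) /\
    sumR (d + i) (fun k => abs2 (u k)) + sumR (d + i) (fun k => abs2 (v k))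
      = sumR d (fun k => abs2 (p k)) /\
    v O = (RtoC (cos x ^ S i) * p O)%C /\
    (forall z, eval d p z = 0%C ->
       eval (d + i) u z = 0%C /\ eval (d + i) v z = 0%C) /\
    (forall z, (w * z)%C = 1%C ->
       eval (d + i) u z = (RtoC (- sin (INR (S i) * x)) * eval d p z)%C /\
       eval (d + i) v z = (RtoC (cos (INR (S i) * x)) * eval d p z)%C).
Proof.
  intros Hw Hp.
  assert (Hcs : cos x ^ 2 + sin x ^ 2 = 1)
    by (pose proof (sin2_cos2 x); unfold Rsqr in *; lra).
  induction i as [|i (u & v & Hsupp & Hen & H0 & Hz & Hw1)].
  (* [diag(w z, 1)] fixes [(0, p)], so the first step is [R] alone; the products with [0] keep the
     two-term shape of [eval_lin] and [abs2_rotate]. *)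
  - exists (fun k => cos x * 0 + (- sin x) * p k)%C,
           (fun k => sin x * 0 + cos x * p k)%C.
    rewrite Nat.add_0_r. repeat split.
    + rewrite Hp by lia; ring.
    + rewrite Hp by lia; ring.
    + rewrite <- sumR_plus. apply sumR_ext; intros.
      rewrite abs2_rotate by exact Hcs. unfold abs2; simpl; ring.
    + rewrite pow_1; ring.
    + rewrite eval_lin, eval_zero, H; ring.
    + rewrite eval_lin, eval_zero, H; ring.
    + rewrite eval_lin, eval_zero; simpl INR; rewrite Rmult_1_l, RtoC_opp; ring.
    + rewrite eval_lin, eval_zero; simpl INR; rewrite Rmult_1_l; ring.
  - exists (fun k => cos x * shift w u k + (- sin x) * v k)%C,
           (fun k => sin x * shift w u k + cos x * v k)%C.
    rewrite Nat.add_succ_r.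
    (* Only [u] is shifted, so [v] gets a vanishing top coefficient when the length grows by one. *)
    assert (Ev : forall z, eval (S (d + i)) v z = eval (d + i) v z).
    { intros z; unfold eval; simpl. destruct (Hsupp (d + i)%nat) as [_ ->]; [lia|ring]. }
    assert (Hs : forall k, (S (d + i) <= k)%nat -> shift w u k = 0%C /\ v k = 0%C).
    { intros [|k] Hk; [lia|]. simpl.
      destruct (Hsupp k) as [-> _]; [lia|].
      destruct (Hsupp (S k)) as [_ ->]; [lia|]. split; ring. }
    repeat split.
    + destruct (Hs k) as [-> ->]; [lia|ring].
    + destruct (Hs k) as [-> ->]; [lia|ring].
    + rewrite <- sumR_plus, <- Hen.
      rewrite (sumR_ext _ _ (fun k => abs2 (shift w u k) + abs2 (v k)))
        by (intros; now apply abs2_rotate).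
      rewrite sumR_plus, sum_abs2_shift by exact Hw. simpl.
      destruct (Hsupp (d + i)%nat) as [_ ->]; [lia|]. unfold abs2 at 3; simpl; ring.
    + simpl shift. rewrite H0. change (cos x ^ S (S i)) with (cos x * cos x ^ S i).
      rewrite RtoC_mult; ring.
    + destruct (Hz z H) as [E1 E2].
      rewrite eval_lin, eval_shift, Ev, E1, E2; ring.
    + destruct (Hz z H) as [E1 E2].
      rewrite eval_lin, eval_shift, Ev, E1, E2; ring.
    (* At [w z = 1] the new factor is [R] itself, so the angles add up. *)
    + destruct (Hw1 z H) as [E1 E2].
      rewrite eval_lin, eval_shift, Ev, E1, E2, H.
      rewrite (S_INR (S i)). replace ((INR (S i) + 1) * x) with (INR (S i) * x + x) by ring.
      rewrite sin_plus, !RtoC_opp, RtoC_plus, !RtoC_mult; ring.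
    + destruct (Hw1 z H) as [E1 E2].
      rewrite eval_lin, eval_shift, Ev, E1, E2, H.
      rewrite (S_INR (S i)). replace ((INR (S i) + 1) * x) with (INR (S i) * x + x) by ring.
      rewrite cos_plus, !RtoC_opp, RtoC_minus, !RtoC_mult; ring.
Qed.

(** Induction on the number of roots, starting from the constant 1. Each pass through
    [rotation_block] with [w = e^(-i theta)] adds the root [e^(i theta)], keeps the earlier roots,
    raises the degree by [i] and multiplies the constant term by [cos(pi/2m)^m], where
    [m = i + 1]. *)
Lemma annihilating_polynomial (n i : nat) (theta : nat -> R) :
  exists p : nat -> C,
    (forall k, (S (n * i) <= k)%nat -> p k = 0%C) /\
    p O = RtoC (cos (PI / (2 * INR (S i))) ^ (n * S i)) /\
    sumR (S (n * i)) (fun k => abs2 (p k)) <= 1 /\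
    (forall j, (j < n)%nat -> eval (S (n * i)) p (cis (theta j)) = 0%C).
Proof.
  induction n as [|n (p & Hsupp & H0 & Hen & Hz)].
  - exists (fun k => match k with O => 1%C | S _ => 0%C end). repeat split.
    + intros [|k]; [simpl; lia|reflexivity].
    + simpl; unfold abs2; simpl; lra.
    + lia.
  - set (x := PI / (2 * INR (S i))) in *.
    destruct (rotation_block _ p (cis (- theta n)) x i (abs2_cis _) Hsupp)
      as (u & v & Hs & He & Hv0 & Hvz & Hv1).
    replace (S (S n * i))%nat with (S (n * i) + i)%nat by lia.
    exists v. repeat split.
    + intros k Hk; now apply Hs.
    + rewrite Hv0, H0, <- RtoC_mult, <- pow_add. f_equal; f_equal; lia.
    (* The energy is shared between [u] and [v]; dropping the part of [u] turns the equality into a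
       bound. *)
    + assert (0 <= sumR (S (n * i) + i) (fun k => abs2 (u k)))
        by (apply sumR_pos; intros; apply abs2_pos). lra.
    + intros j Hj. destruct (Nat.eq_dec j n) as [->|Hne].
      * destruct (Hv1 (cis (theta n))) as [_ ->].
        { rewrite <- cis_plus, Rplus_opp_l; apply cis_0. }
        (* The [i + 1] rotations add up to a quarter turn, whose cosine is the zero at the new
           root. *)
        replace (INR (S i) * x) with (PI / 2).
        { rewrite cos_PI2; ring. }
        unfold x; field. apply not_0_INR; lia.
      * apply Hvz, Hz; lia.
Qed.

(** * Exponential sums and the sampling inequality *)

Definition expsum (n : nat) (a b lam : nat -> R) (t : R) : C :=
  (expsum_re n a b lam t, expsum_im n a b lam t).

Lemma expsum_S (n : nat) (a b lam : nat -> R) (t : R) :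
  expsum (S n) a b lam t = (expsum n a b lam t + (a n, b n) * cis (lam n * t))%C.
Proof.
  unfold expsum, expsum_re, expsum_im, cis, Cplus, Cmult; simpl; f_equal; ring.
Qed.

(** Each exponential contributes its value at [t] times [p] evaluated at [e^(i lam_j s)], which is
    zero. *)
Lemma annihilates_expsum (N n : nat) (a b lam : nat -> R) (p : nat -> C) (t s : R) :
  (forall j, (j < n)%nat -> eval N p (cis (lam j * s)) = 0%C) ->
  sumC N (fun k => p k * expsum n a b lam (t + INR k * s))%C = 0%C.
Proof.
  induction n as [|n IH]; intros H.
  - transitivity (eval N (fun _ => 0%C) 0%C); [|apply eval_zero].
    apply sumC_ext; intros; unfold expsum, expsum_re, expsum_im; simpl.
    change (0, 0) with (RtoC 0); ring.
  - transitivity (sumC N (fun k =>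
      1 * (p k * expsum n a b lam (t + INR k * s))
      + ((a n, b n) * cis (lam n * t)) * (p k * cis (lam n * s) ^ k))%C).
    + apply sumC_ext; intros k _. rewrite expsum_S, <- cis_mult_nat.
      replace (lam n * (t + INR k * s)) with (lam n * t + INR k * (lam n * s)) by ring.
      rewrite cis_plus; ring.
    + rewrite sumC_lin, IH by (intros; apply H; lia).
      change (sumC N _) with (eval N p (cis (lam n * s))).
      rewrite H by lia; ring.
Qed.

Lemma bernoulli_minus (x : R) (n : nat) : 0 <= x <= 1 -> 1 - INR n * x <= (1 - x) ^ n.
Proof.
  intros Hx; induction n as [|n IH]; [simpl; lra|].
  rewrite S_INR; simpl.
  assert (0 <= INR n) by apply pos_INR.
  assert ((1 - x) * (1 - INR n * x) <= (1 - x) * (1 - x) ^ n)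
    by (apply Rmult_le_compat_l; lra).
  nra.
Qed.

(** With [x = pi/2m], the right side is [(1 - sin^2 x)^(nm)]. Bernoulli and [sin x <= x] bound it
    below by [1 - n m x^2]. *)
Lemma cos_pow_lower_bound (n m : nat) : (1 <= m)%nat ->
  1 - INR n * PI ^ 2 / (4 * INR m) <= (cos (PI / (2 * INR m)) ^ (n * m)) ^ 2.
Proof.
  intros Hm.
  assert (H1 : 1 <= INR m) by (apply (le_INR 1); exact Hm).
  pose proof PI_RGT_0 as Hpi.
  set (x := PI / (2 * INR m)).
  assert (Hx : 0 < x) by (apply Rdiv_lt_0_compat; lra).
  assert (Hx2 : x <= PI / 2).
  { unfold x, Rdiv. apply Rmult_le_compat_l; [lra|]. apply Rinv_le_contravar; lra. }
  assert (Hs : 0 <= sin x <= x).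
  { split; [apply sin_ge_0; lra | left; now apply sin_lt_x]. }
  pose proof (SIN_bound x).
  rewrite <- pow_mult, Nat.mul_comm, pow_mult.
  replace (cos x ^ 2) with (1 - sin x ^ 2)
    by (pose proof (sin2_cos2 x); unfold Rsqr in *; lra).
  eapply Rle_trans; [|apply bernoulli_minus; nra].
  rewrite mult_INR.
  replace (INR n * PI ^ 2 / (4 * INR m)) with (INR n * INR m * x ^ 2)
    by (unfold x; field; lra).
  assert (INR n * INR m * sin x ^ 2 <= INR n * INR m * x ^ 2); [|lra].
  apply Rmult_le_compat_l; [|nra].
  apply Rmult_le_pos; apply pos_INR.
Qed.

Lemma sampling_inequality (n i : nat) (a b lam : nat -> R) (t s : R) :
  (1 - INR n * PI ^ 2 / (4 * INR (S i))) * expsum_abs2 n a b lam t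
  <= INR n * PI ^ 2 / (4 * INR (S i))
     * sumR (n * i) (fun k => expsum_abs2 n a b lam (t + INR (S k) * s)).
Proof.
  destruct (annihilating_polynomial n i (fun j => lam j * s))
    as (p & _ & H0 & Hen & Hz).
  pose proof (annihilates_expsum _ _ a b lam p t s Hz) as Han.
  pose proof (cos_pow_lower_bound n (S i) ltac:(lia)) as Hq.
  set (c := cos _ ^ (n * S i)) in *.
  set (x := INR n * PI ^ 2 / (4 * INR (S i))) in *.
  rewrite sumC_first in Han. rewrite sumR_first in Hen.
  rewrite H0 in Han, Hen. cbv beta in Han, Hen.
  simpl (INR 0) in Han. rewrite Rmult_0_l, Rplus_0_r in Han.
  pose proof (cauchy_schwarz (n * i) (fun k => p (S k))
    (fun k => expsum n a b lam (t + INR (S k) * s))) as CS. cbv beta in CS.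
  assert (E : abs2 (sumC (n * i) (fun k => p (S k) * expsum n a b lam (t + INR (S k) * s))%C)
              = c ^ 2 * expsum_abs2 n a b lam t).
  { replace (sumC _ _) with (RtoC (- c) * expsum n a b lam t)%C.
    - rewrite abs2_mult. unfold abs2 at 1. simpl fst; simpl snd.
      change (abs2 (expsum n a b lam t)) with (expsum_abs2 n a b lam t). ring.
    - rewrite RtoC_opp.
      transitivity (RtoC 0 + - RtoC c * expsum n a b lam t)%C; [ring|].
      rewrite <- Han; ring. }
  rewrite E in CS.
  change (fun k => abs2 (expsum n a b lam (t + INR (S k) * s)))
    with (fun k => expsum_abs2 n a b lam (t + INR (S k) * s)) in CS.
  assert (HF : 0 <= expsum_abs2 n a b lam t) by (apply (abs2_pos (expsum n a b lam t))).
  assert (HS : 0 <= sumR (n * i) (fun k => expsum_abs2 n a b lam (t + INR (S k) * s))).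
  { apply sumR_pos; intros k. apply (abs2_pos (expsum n a b lam _)). }
  assert (Hc : abs2 (RtoC c) = c ^ 2) by (unfold abs2; simpl; ring).
  rewrite Hc in Hen.
  set (P := sumR (n * i) (fun k => abs2 (p (S k)))) in *.
  set (F := expsum_abs2 n a b lam t) in *.
  set (G := sumR (n * i) (fun k => expsum_abs2 n a b lam _)) in *.
  (* The bound [1 - x <= c^2] serves twice: here on the left, and then on the right through
     [P <= 1 - c^2 <= x]. *)
  apply Rle_trans with (c ^ 2 * F); [apply Rmult_le_compat_r; lra|].
  apply Rle_trans with (P * G); [exact CS|].
  apply Rmult_le_compat_r; lra.
Qed.

(** * From samples to integrals *)

(** By uniform continuity on [[0,1]], on a short cell [g] stays above its right endpoint value minus
    [eps]. Integrating over the cells gives this one-sided Riemann sum estimate. *)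
Lemma right_endpoint_sum_le (g : R -> R) (eps : R) :
  (forall x, continuous g x) -> 0 < eps ->
  exists N0 : nat, forall N : nat, (N0 <= N)%nat -> (1 <= N)%nat ->
    sumR N (fun k => g (INR (S k) / INR N)) <= INR N * (RInt g 0 1 + eps).
Proof.
  intros Hg Heps.
  destruct (@Heine_cor2 g 0 1 (fun x _ => proj2 (continuity_pt_filterlim g x) (Hg x))
    (mkposreal eps Heps)) as [delta Hd]; simpl in Hd.
  destruct (archimed_cor1 delta (cond_pos delta)) as [N0 [HN0 HN0pos]].
  exists N0; intros N HN HN1.
  assert (HNr : 1 <= INR N) by (apply (le_INR 1); exact HN1).
  assert (Hinv : / INR N < delta).
  { eapply Rle_lt_trans; [|exact HN0].
    apply Rinv_le_contravar; [apply (lt_INR 0); lia|apply le_INR; lia]. }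
  assert (Hex : forall u v, ex_RInt g u v) by (intros; apply (ex_RInt_continuous (V := R_CompleteNormedModule)); auto).
  (* The induction adds one cell at a time, comparing with the integral up to [K/N]. *)
  assert (H : forall K, (K <= N)%nat ->
    sumR K (fun k => g (INR (S k) / INR N))
      <= INR N * RInt g 0 (INR K / INR N) + INR K * eps).
  { induction K as [|K IH]; intros HK.
    - simpl. unfold Rdiv; rewrite Rmult_0_l, RInt_point.
      change zero with 0; lra.
    - specialize (IH ltac:(lia)). cbn [sumR].
      set (u := INR K / INR N) in *. set (v := INR (S K) / INR N) in *.
      assert (Huv : v - u = / INR N) by (unfold u, v; rewrite S_INR; field; lra).
      assert (Hi : 0 < / INR N) by (apply Rinv_0_lt_compat; lra).
      assert (Hu : 0 <= u) by (apply Rmult_le_pos; [apply pos_INR|lra]).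
      assert (Hv : v <= 1).
      { apply Rmult_le_reg_r with (INR N); [lra|]. unfold v, Rdiv.
        rewrite Rmult_assoc, Rinv_l, Rmult_1_r, Rmult_1_l by lra. now apply le_INR. }
      rewrite <- (RInt_Chasles g 0 u v) by apply Hex.
      change plus with Rplus.
      assert (Hle : (v - u) * (g v - eps) <= RInt g u v).
      { replace ((v - u) * (g v - eps)) with (RInt (fun _ => g v - eps) u v)
          by (rewrite RInt_const; reflexivity).
        apply RInt_le; [lra|apply ex_RInt_const|apply Hex|].
        intros y Hy.
        assert (Hlt : Rabs (v - y) < delta) by (rewrite Rabs_pos_eq; lra).
        specialize (Hd v y ltac:(lra) ltac:(lra) Hlt).
        apply Rabs_def2 in Hd; lra. }
      rewrite Huv in Hle.
      assert (g v - eps <= INR N * RInt g u v).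
      { replace (g v - eps) with (INR N * (/ INR N * (g v - eps))) by (field; lra).
        apply Rmult_le_compat_l; lra. }
      rewrite S_INR; lra. }
  specialize (H N ltac:(lia)). unfold Rdiv at 2 in H. rewrite Rinv_r in H by lra. lra.
Qed.

Lemma continuous_sumR (n : nat) (g : nat -> R -> R) (x : R) :
  (forall k, continuous (g k) x) -> continuous (fun t => sumR n (fun k => g k t)) x.
Proof.
  intros H; induction n as [|n IH]; simpl.
  - apply continuous_const.
  - apply (continuous_plus (fun t => sumR n (fun k => g k t)) (g n)); auto.
Qed.

Lemma expsum_abs2_continuous (n : nat) (a b lam : nat -> R) (x : R) :
  continuous (expsum_abs2 n a b lam) x.
Proof.
  assert (Hsq : forall f : R -> R, continuous f x -> continuous (fun t => f t ^ 2) x).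
  { intros f Hf. apply (continuous_comp f (fun y => y ^ 2)); [exact Hf|].
    apply (ex_derive_continuous (fun y => y ^ 2)); auto_derive; exact I. }
  apply (continuous_plus (fun t => expsum_re n a b lam t ^ 2)
                         (fun t => expsum_im n a b lam t ^ 2));
    apply Hsq; apply (continuous_sumR n (fun j t => _)); intros k;
    apply (ex_derive_continuous (V := R_NormedModule)); auto_derive; exact I.
Qed.

Lemma expsum_abs2_affine_continuous (n : nat) (a b lam : nat -> R) (u t x : R) :
  continuous (fun y => expsum_abs2 n a b lam (u * y + t)) x.
Proof.
  apply (continuous_comp (fun y => u * y + t) (expsum_abs2 n a b lam)).
  - apply (ex_derive_continuous (fun y => u * y + t)); auto_derive; exact I.
  - apply expsum_abs2_continuous.
Qed.

(** The endpoint bound: for nonzero [u] the integral is the mean of [F] over the segment between [t]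
    and [t + u]. The sign of [u] is free, so [t] may be either end. The sampling step is [u/(n i)],
    with [i] large. *)
Lemma expsum_abs2_le_RInt_segment (n : nat) (a b lam : nat -> R) (t u : R) :
  (1 <= n)%nat ->
  expsum_abs2 n a b lam t
  <= (PI * INR n / 2) ^ 2 * RInt (fun y => expsum_abs2 n a b lam (u * y + t)) 0 1.
Proof.
  intros Hn.
  set (F := expsum_abs2 n a b lam).
  set (g := fun y => F (u * y + t)).
  assert (Hg : forall x, continuous g x) by (intros; apply expsum_abs2_affine_continuous).
  assert (HF : 0 <= F t) by apply (abs2_pos (expsum n a b lam t)).
  assert (HI : 0 <= RInt g 0 1).
  { apply RInt_ge_0; [lra|apply (ex_RInt_continuous (V := R_CompleteNormedModule)); auto|].
    intros; apply (abs2_pos (expsum n a b lam _)). }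
  assert (Hn1 : 1 <= INR n) by (apply (le_INR 1); exact Hn).
  pose proof PI_RGT_0 as Hpi.
  set (K := (PI * INR n / 2) ^ 2).
  assert (HK : 0 < K) by (apply pow_lt; nra).
  apply le_epsilon; intros eta Heta.
  (* Half of [eta] pays for the Riemann sum error [K * eps], the other half for the term [x * F t]
     of the sampling inequality. *)
  set (eps := eta / (2 * K)).
  assert (Heps : 0 < eps) by (apply Rdiv_lt_0_compat; lra).
  destruct (right_endpoint_sum_le g eps Hg Heps) as [N0 HN0].
  set (M := INR n * PI ^ 2 / 4 * F t).
  assert (HM : 0 <= M).
  { apply Rmult_le_pos; [|exact HF]. nra. }
  (* [M + 1] instead of [M] keeps the denominator positive when [F t = 0]. *)
  destruct (archimed_cor1 (eta / (2 * (M + 1)))) as [m [Hm Hm0]].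
  { apply Rdiv_lt_0_compat; lra. }
  set (i := S (m + N0)).
  assert (Hi : 1 <= INR i) by (apply (le_INR 1); unfold i; lia).
  pose proof (sampling_inequality n i a b lam t (u / INR (n * i))) as Hs.
  fold F in Hs.
  specialize (HN0 (n * i)%nat ltac:(unfold i; nia) ltac:(unfold i; nia)).
  rewrite (sumR_ext _ _ (fun k => g (INR (S k) / INR (n * i)))) in Hs.
  2:{ intros k _; unfold g; f_equal. field. apply not_0_INR; unfold i; lia. }
  rewrite mult_INR in HN0, Hs. rewrite S_INR in Hs.
  set (x := INR n * PI ^ 2 / (4 * (INR i + 1))) in *.
  assert (Hx : 0 <= x) by (apply Rmult_le_pos; [nra|left; apply Rinv_0_lt_compat; lra]).
  (* With [n (i + 1)] in place of [n i] the product is exactly [n^2 pi^2/4 = K]. *)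
  assert (Hxn : x * (INR n * INR i) <= K).
  { replace K with (x * (INR n * (INR i + 1))) by (unfold x, K; field; lra).
    apply Rmult_le_compat_l; nra. }
  assert (HxF : x * F t <= eta / 2).
  { replace (x * F t) with (M * / (INR i + 1)) by (unfold x, M; field; lra).
    apply Rle_trans with ((M + 1) * / INR m).
    - apply Rmult_le_compat; [lra|left; apply Rinv_0_lt_compat; lra|lra|].
      apply Rinv_le_contravar; [apply (lt_INR 0); lia|].
      assert (INR m <= INR i) by (apply le_INR; unfold i; lia). lra.
    - replace (eta / 2) with ((M + 1) * (eta / (2 * (M + 1)))) by (field; lra).
      apply Rmult_le_compat_l; lra. }
  assert (Hup : x * sumR (n * i) (fun k => g (INR (S k) / (INR n * INR i)))
                <= K * (RInt g 0 1 + eps)).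
  { apply Rle_trans with (x * (INR n * INR i * (RInt g 0 1 + eps))).
    - now apply Rmult_le_compat_l.
    - rewrite <- Rmult_assoc. apply Rmult_le_compat_r; lra. }
  replace (K * (RInt g 0 1 + eps)) with (K * RInt g 0 1 + eta / 2) in Hup
    by (unfold eps; field; lra).
  lra.
Qed.

Theorem theorem2p3 :
  forall (n : nat), (1 <= n)%nat ->
  forall (a b lam : nat -> R),
  (forall i j : nat, (i < j)%nat -> (j < n)%nat -> lam i < lam j) ->
  forall (pr : Riemann_integrable (expsum_abs2 n a b lam) 0 1),
  forall t : R, 0 <= t <= 1 ->
  expsum_abs n a b lam t <= PI * INR n / 2 * sqrt (RiemannInt pr).
Proof.
  intros n Hn a b lam _ pr t Ht.
  rewrite <- (RInt_Reals _ _ _ pr).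
  set (F := expsum_abs2 n a b lam).
  assert (Hex : forall u v, ex_RInt F u v)
    by (intros; apply (ex_RInt_continuous (V := R_CompleteNormedModule)); intros; apply expsum_abs2_continuous).
  assert (Hexc : forall u, ex_RInt (fun y => F (u * y + t)) 0 1).
  { intros u; apply (ex_RInt_continuous (V := R_CompleteNormedModule)); intros z _.
    apply expsum_abs2_affine_continuous. }
  (* Change of variables, multiplied by [u] so that it also covers a segment of length zero, when
     [t] is 0 or 1. *)
  assert (Hlin : forall u, u * RInt (fun y => F (u * y + t)) 0 1 = RInt F t (u + t)).
  { intros u. pose proof (RInt_comp_lin F u t 0 1 (Hex _ _)) as E.
    rewrite RInt_scal in E by apply Hexc.
    replace (u * 0 + t) with t in E by ring.
    now rewrite Rmult_1_r in E. }
  pose proof (expsum_abs2_le_RInt_segment n a b lam t (1 - t) Hn) as Hr.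
  pose proof (expsum_abs2_le_RInt_segment n a b lam t (- t) Hn) as Hl.
  fold F in Hr, Hl.
  pose proof (Hlin (1 - t)) as Er; pose proof (Hlin (- t)) as El.
  replace (1 - t + t) with 1 in Er by ring.
  rewrite Rplus_opp_l, <- (opp_RInt_swap F 0 t) in El by apply Hex.
  change opp with Ropp in El.
  pose proof (RInt_Chasles F 0 t 1 (Hex _ _) (Hex _ _)) as Ech.
  change plus with Rplus in Ech.
  assert (HK : 0 <= PI * INR n / 2).
  { pose proof PI_RGT_0; pose proof (pos_INR n); nra. }
  set (c := PI * INR n / 2) in *.
  assert (H : F t <= c ^ 2 * RInt F 0 1).
  { rewrite <- Ech, <- Er.
    replace (RInt F 0 t) with (t * RInt (fun y => F (- t * y + t)) 0 1) by lra.
    (* Weighting the two endpoint bounds by the segment lengths [t] and [1 - t] turns the means back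
       into integrals, which add up to the integral over [[0,1]]. *)
    replace (F t) with (t * F t + (1 - t) * F t) by ring.
    assert (t * F t <= t * (c ^ 2 * RInt (fun y => F (- t * y + t)) 0 1))
      by (apply Rmult_le_compat_l; lra).
    assert ((1 - t) * F t <= (1 - t) * (c ^ 2 * RInt (fun y => F ((1 - t) * y + t)) 0 1))
      by (apply Rmult_le_compat_l; lra).
    lra. }
  unfold expsum_abs; fold F.
  rewrite <- (sqrt_pow2 c HK), <- sqrt_mult_alt by apply pow2_ge_0.
  now apply sqrt_le_1_alt.
Qed.
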